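(* Say a word $\sigma=\sigma_1\cdots\sigma_n$ over $\{1,\dots,k\}$ avoids $122$ if there is no index $i$ with $\sigma_i<\sigma_{i+1}=\sigma_{i+2}$, and let $F_{122}(x;k)=\sum_{n\ge0}f_{122}(n,k)x^n$, where $f_{122}(n,k)$ is the number of such words of length $n$. Then for all $k\ge0$, \[ F_{122}(x;k)=\frac{x}{(1-x^2)^k-(1-x)}. \]
   Context: The empty word (length $0$) is counted once; for $k=0$ there are no words of positive length. *)

(* Defs.v *)
From HB Require Import structures.
From mathcomp Require Import all_boot all_order all_algebra.
From mathcomp Require Import boolp.

Set Implicit Arguments.
Unset Strict Implicit.
Unset Printing Implicit Defensive.

Import GRing.Theory.
Local Open Scope ring_scope.

(** * Words avoiding 122 *)

(* [size s - 2] is truncated, so [i] ranges over exactly the positions (from 0)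
   with [i + 2 < size s], and [nth] never reaches its default value. *)
Definition contains122 (s : seq nat) : bool :=
  [exists i : 'I_(size s - 2),
     (nth 0 s i < nth 0 s i.+1)%N && (nth 0 s i.+1 == nth 0 s i.+2)]%N.

(* The letters 1, ..., k are represented by 'I_k = {0, ..., k-1}: the pattern
   depends only on the relative order of the letters. *)
Definition f122 (n k : nat) : nat :=
  #|[set w : n.-tuple 'I_k | ~~ contains122 (map val w)]|.

(** * The ring R[[x]] of formal power series *)

Record fps (R : Type) := Fps { coefs : nat -> R }.

Lemma fpsP (R : Type) (f g : fps R) : coefs f =1 coefs g <-> f = g.
Proof.
split=> [|->] //; case: f g => [f] [g] /= fg.
by congr Fps; apply/funext.
Qed.

HB.instance Definition _ (R : Type) := gen_eqMixin (fps R).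
HB.instance Definition _ (R : Type) := gen_choiceMixin (fps R).

Section FpsZmodule.
Variable R : zmodType.
Implicit Types f g h : fps R.

Definition fps_zero : fps R := Fps (fun=> 0).
Definition fps_opp f : fps R := Fps (fun n => - coefs f n).
Definition fps_add f g : fps R := Fps (fun n => coefs f n + coefs g n).

Fact fps_addA : associative fps_add.
Proof. by move=> f g h; apply/fpsP => n /=; rewrite addrA. Qed.
Fact fps_addC : commutative fps_add.
Proof. by move=> f g; apply/fpsP => n /=; rewrite addrC. Qed.
Fact fps_add0 : left_id fps_zero fps_add.
Proof. by move=> f; apply/fpsP => n /=; rewrite add0r. Qed.
Fact fps_addN : left_inverse fps_zero fps_opp fps_add.
Proof. by move=> f; apply/fpsP => n /=; rewrite addNr. Qed.

HB.instance Definition _ :=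
  GRing.isZmodule.Build (fps R) fps_addA fps_addC fps_add0 fps_addN.

Lemma coefs0 n : coefs (0 : fps R) n = 0. Proof. by []. Qed.
Lemma coefsN f n : coefs (- f) n = - coefs f n. Proof. by []. Qed.
Lemma coefsD f g n : coefs (f + g) n = coefs f n + coefs g n.
Proof. by []. Qed.
Lemma coefsB f g n : coefs (f - g) n = coefs f n - coefs g n.
Proof. by []. Qed.

End FpsZmodule.

Section FpsRing.
Variable R : comNzRingType.
Implicit Types f g h : fps R.

Definition fps_one : fps R := Fps (fun n => (n == 0%N)%:R).
Definition fps_mul f g : fps R :=
  Fps (fun n => \sum_(i < n.+1) coefs f i * coefs g (n - i)).

Definition fps_trunc (m : nat) f : {poly R} := \poly_(i < m) coefs f i.

Lemma coef_fps_trunc m f n :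
  (n < m)%N -> (fps_trunc m f)`_n = coefs f n.
Proof. by move=> nm; rewrite coef_poly nm. Qed.

Lemma coefs_mul_trunc m f g n : (n < m)%N ->
  coefs (fps_mul f g) n = (fps_trunc m f * fps_trunc m g)`_n.
Proof.
move=> nm; rewrite coefM /=; apply: eq_bigr => i _.
by rewrite !coef_fps_trunc // (leq_ltn_trans _ nm) ?leq_subr // -ltnS.
Qed.

Fact fps_mulC : commutative fps_mul.
Proof.
move=> f g; apply/fpsP => n.
by rewrite !(@coefs_mul_trunc n.+1) // mulrC.
Qed.

Fact fps_mulA : associative fps_mul.
Proof.
move=> f g h; apply/fpsP => n.
transitivity ((fps_trunc n.+1 f * fps_trunc n.+1 g * fps_trunc n.+1 h)`_n).
  rewrite -mulrA coefM /=; apply: eq_bigr => i _.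
  rewrite coef_fps_trunc //; congr (_ * _).
  by rewrite -coefs_mul_trunc // ltnS leq_subr.
rewrite coefM /=; apply: eq_bigr => i _.
by rewrite -coefs_mul_trunc // coef_fps_trunc // ltnS leq_subr.
Qed.

Fact fps_mul1 : left_id fps_one fps_mul.
Proof.
move=> f; apply/fpsP => n /=.
rewrite big_ord_recl /= mul1r subn0 big1 ?addr0 // => i _.
by rewrite mul0r.
Qed.

Fact fps_mulDl : left_distributive fps_mul +%R.
Proof.
move=> f g h; apply/fpsP => n; rewrite /= -big_split /=.
by apply: eq_bigr => i _; rewrite mulrDl.
Qed.

Fact fps_one_neq0 : fps_one != 0.
Proof.
apply/eqP => /fpsP /(_ 0%N) /= /eqP.
by rewrite oner_eq0.
Qed.

HB.instance Definition _ := GRing.Zmodule_isComNzRing.Build (fps R)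
  fps_mulA fps_mulC fps_mul1 fps_mulDl fps_one_neq0.

Lemma coefs1 n : coefs (1 : fps R) n = (n == 0%N)%:R. Proof. by []. Qed.
Lemma coefsM f g n :
  coefs (f * g) n = \sum_(i < n.+1) coefs f i * coefs g (n - i).
Proof. by []. Qed.

Definition fpsX : fps R := Fps (fun n => (n == 1%N)%:R).

Definition fps_unit : {pred fps R} := fun f => `[< exists g, g * f = 1 >].
Definition fps_inv f : fps R :=
  if pselect (exists g, g * f = 1) is left fu then projT1 (cid fu) else f.

Fact fps_mulV : {in fps_unit, left_inverse 1 fps_inv *%R}.
Proof.
move=> f /asboolP fu; rewrite /fps_inv.
by case: pselect => // {}fu; case: (cid fu).
Qed.
Fact fps_unitPl f g : g * f = 1 -> fps_unit f.
Proof. by move=> gf; apply/asboolP; exists g. Qed.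
Fact fps_inv_out : {in [predC fps_unit], fps_inv =1 id}.
Proof.
by move=> f /asboolP fu; rewrite /fps_inv; case: pselect.
Qed.

HB.instance Definition _ := GRing.ComNzRing_hasMulInverse.Build (fps R)
  fps_mulV fps_unitPl fps_inv_out.

End FpsRing.

Section FpsIdomain.
Variable R : idomainType.
Implicit Types f g h : fps R.

Lemma fps_neq0_ord f : f != 0 ->
  exists2 m, coefs f m != 0 & forall i, (i < m)%N -> coefs f i = 0.
Proof.
move=> f0; have /ex_minnP[m fm mP] : exists n, coefs f n != 0.
  apply: contrapT => /forallNP H; move/eqP: f0; apply.
  by apply/fpsP => n; rewrite coefs0; apply/eqP/negPn/negP/H.
exists m => // i im; apply/eqP/negPn/negP => /mP.
by rewrite leqNgt im.
Qed.

Fact fps_idomain : GRing.integral_domain_axiom (fps R).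
Proof.
move=> f g fg; apply/negPn/negP; rewrite negb_or => /andP[].
move=> /fps_neq0_ord[m fm fP] /fps_neq0_ord[n gn gP].
have mn : (m < (m + n).+1)%N by rewrite ltnS leq_addr.
have /eqP := congr1 (fun h => coefs h (m + n)) fg.
rewrite coefsM (bigD1 (Ordinal mn)) //= addKn big1 ?addr0 => [|i im].
  by rewrite mulf_eq0 (negPf fm) (negPf gn).
have [lim|lmi|/val_inj eim] := ltngtP i (Ordinal mn).
- by rewrite fP ?mul0r.
- rewrite gP ?mulr0 // -(ltn_add2l i) subnKC ?ltn_add2r //.
  by rewrite -ltnS.
- by rewrite eim eqxx in im.
Qed.

HB.instance Definition _ :=
  GRing.ComUnitRing_isIntegral.Build (fps R) fps_idomain.

End FpsIdomain.

(** * The generating function *)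

Definition F122 (k : nat) : fps int := Fps (fun n => (f122 n k)%:Z).

(* The denominator (1 - x^2)^k - (1 - x) has zero constant term, so it is not a
   unit of Z[[x]] and the quotient is taken in the fraction field of Z[[x]]. *)
Notation fracps f := (@FracField.tofrac (fps int) f).

(* Main.v *)
Require Import Defs.
From mathcomp Require Import all_boot all_order all_algebra.
From mathcomp Require Import ring.
Import GRing.Theory.
Local Open Scope ring_scope.

(** Deleting the first letter of a 122-avoiding word [a w] gives an avoiding
    word [w] that does not start with [b b] for some [b > a]; and [b b w']
    avoids 122 iff [b w'] does.  Hence, if [x G_a] counts the avoiding words with
    first letter [a], then [G_a + x^2 \sum_(b > a) G_b = F].  By descending
    induction on [j], [F - x^2 \sum_(b >= j) G_b = (1 - x^2)^(k - j) F]; taking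
    [j = 0] and using [F = 1 + x \sum_a G_a] gives the formula. *)

Lemma contains122P (s : seq nat) :
  reflect (exists i, [/\ (i.+2 < size s)%N, (nth 0 s i < nth 0 s i.+1)%N
                       & nth 0%N s i.+1 = nth 0%N s i.+2])
          (contains122 s).
Proof.
apply: (iffP existsP) => [[i /andP[lt_s /eqP eq_s]]|[i [lt_i lt_s eq_s]]].
  by exists i; split=> //; have := ltn_ord i; rewrite ltn_subRL.
have lt_i' : (i < size s - 2)%N by rewrite ltn_subRL.
by exists (Ordinal lt_i'); rewrite /= lt_s eq_s eqxx.
Qed.

Lemma contains122_short (s : seq nat) : (size s <= 2)%N -> contains122 s = false.
Proof.
move=> le_s; apply/contains122P => -[i [lt_i _ _]].
by have := leq_trans lt_i le_s.
Qed.

Lemma contains122_cons3 (a b d : nat) (s : seq nat) :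
  contains122 [:: a, b, d & s]
    = (a < b)%N && (b == d) || contains122 [:: b, d & s].
Proof.
apply/contains122P/idP => [[[|i] [/= lt_i lt_s eq_s]]|].
- by rewrite lt_s eq_s eqxx.
- by apply/orP; right; apply/contains122P; exists i.
- case/orP => [/andP[lt_ab /eqP eq_bd]|/contains122P[i [lt_i lt_s eq_s]]].
    by exists 0%N.
  by exists i.+1.
Qed.

(** An occurrence of the pattern at the first position would need [b < b]. *)
Lemma contains122_double (b : nat) (s : seq nat) :
  contains122 [:: b, b & s] = contains122 (b :: s).
Proof.
case: s => [|d s]; first by rewrite !contains122_short.
by rewrite contains122_cons3 ltnn.
Qed.

Lemma sum_tuple_cons (V : nmodType) (T : finType) (n : nat)
    (E : n.+1.-tuple T -> V) :
  \sum_(w : n.+1.-tuple T) E w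
    = \sum_(a : T) \sum_(w : n.-tuple T) E (cons_tuple a w).
Proof.
rewrite pair_big /= (reindex (fun p : T * n.-tuple T => cons_tuple p.1 p.2)) //.
exists (fun w : n.+1.-tuple T => (thead w, behead_tuple w)) => [[a w] _|w _] /=.
  by congr (_, _); apply: val_inj.
by rewrite [RHS]tuple_eta; apply: val_inj.
Qed.

Lemma coefsXM_0 (R : comNzRingType) (f : fps R) : coefs (fpsX R * f) 0 = 0.
Proof. by rewrite coefsM big_ord1 mul0r. Qed.

Lemma coefsXM_S (R : comNzRingType) (f : fps R) (n : nat) :
  coefs (fpsX R * f) n.+1 = coefs f n.
Proof.
rewrite coefsM 2!big_ord_recl big1 => [|i _]; last by rewrite mul0r.
by rewrite mul0r add0r mul1r addr0 /bump /= subn1.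
Qed.

Lemma coefs_sum (R : zmodType) (I : Type) (r : seq I) (P : pred I)
    (f : I -> fps R) (n : nat) :
  coefs (\sum_(i <- r | P i) f i) n = \sum_(i <- r | P i) coefs (f i) n.
Proof. exact: (big_morph (fun g : fps R => coefs g n)). Qed.

(* The exponent of [x] is the number of letters that follow the prefix [s]. *)
Definition avoiding (k : nat) (s : seq nat) : fps int :=
  Fps (fun n => \sum_(w : n.-tuple 'I_k)
                  (~~ contains122 (s ++ map val w))%:R).

Lemma F122_avoiding (k : nat) : F122 k = avoiding k [::].
Proof.
apply/fpsP => n /=; rewrite /f122 cardsE -sum1_card -natz natr_sum big_mkcond.
by apply: eq_bigr => w _; rewrite unfold_in /=; case: contains122.
Qed.

(** Either no letter follows the prefix, which gives the constant term, or the next letter [a] joins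
    the prefix at the cost of one factor [x]. *)
Lemma avoiding_rcons (k : nat) (s : seq nat) :
  avoiding k s = (~~ contains122 s)%:R
                   + fpsX int * \sum_(a < k) avoiding k (rcons s a).
Proof.
apply/fpsP => -[|n]; rewrite coefsD.
  rewrite coefsXM_0 addr0 /= (eq_bigr (fun=> (~~ contains122 s)%:R)).
    by rewrite sumr_const card_tuple expn0 mulr1n; case: contains122.
  by move=> w _; rewrite tuple0 cats0.
have -> : coefs ((~~ contains122 s)%:R : fps int) n.+1 = 0.
  by case: contains122.
rewrite coefsXM_S add0r coefs_sum /= sum_tuple_cons.
by apply: eq_bigr => a _; apply: eq_bigr => w _; rewrite cat_rcons.
Qed.

Lemma avoiding_double (k b : nat) : avoiding k [:: b; b] = avoiding k [:: b].
Proof.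
by apply/fpsP => n /=; apply: eq_bigr => w _; rewrite contains122_double.
Qed.

Lemma avoiding_cons3 (k a b d : nat) :
  avoiding k [:: a; b; d]
    = avoiding k [:: b; d]
        - (if (a < b)%N && (b == d) then avoiding k [:: b] else 0).
Proof.
case: ifP => [/andP[lt_ab /eqP <-]|ab_d].
  (* The prefix [a b b] is itself an occurrence, so the left side is zero; on the right, [b b] and
     [b] have the same series and cancel. *)
  rewrite avoiding_double subrr; apply/fpsP => n /=.
  by apply: big1 => w _; rewrite contains122_cons3 lt_ab eqxx.
rewrite subr0; apply/fpsP => n /=.
by apply: eq_bigr => w _; rewrite contains122_cons3 ab_d.
Qed.

(** Putting [a] in front of [b] only loses the words whose next letter is again [b], and only when
    [a < b]; that repeated letter accounts for the factor [x]. *)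
Lemma avoiding_cons2 (k a : nat) (b : 'I_k) :
  avoiding k [:: a; val b]
    = avoiding k [:: val b]
        - (if (a < b)%N then fpsX int * avoiding k [:: val b] else 0).
Proof.
rewrite avoiding_rcons [X in _ = X - _]avoiding_rcons /= !contains122_short //.
under eq_bigr do rewrite avoiding_cons3.
rewrite sumrB mulrBr addrA; congr (_ - _).
rewrite (bigD1 b) //= eqxx andbT big1 => [|d ne_db]; last first.
  by rewrite (inj_eq val_inj) eq_sym (negPf ne_db) andbF.
by rewrite addr0; case: ifP; rewrite ?mulr0.
Qed.

Lemma avoiding_first (k a : nat) :
  avoiding k [:: a]
    = avoiding k [::] - fpsX int ^+ 2 * \sum_(a.+1 <= b < k) avoiding k [:: b].
Proof.
rewrite avoiding_rcons [avoiding k [::]]avoiding_rcons !contains122_short //=.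
under eq_bigr do rewrite avoiding_cons2.
rewrite sumrB mulrBr addrA; congr (_ - _).
(* One factor [x] comes from the second letter [b], the other from its repetition. *)
rewrite expr2 -mulrA; congr (_ * _).
by rewrite mulr_sumr (big_nat_widenl _ 0) // big_mkord [RHS]big_mkcond.
Qed.

Lemma avoiding_tail (k i : nat) : (i <= k)%N ->
  avoiding k [::] - fpsX int ^+ 2 * \sum_(k - i <= b < k) avoiding k [:: b]
    = (1 - fpsX int ^+ 2) ^+ i * avoiding k [::].
Proof.
elim: i => [|i IHi] lt_ik.
  by rewrite subn0 big_geq // mulr0 subr0 mul1r.
have ltk : (k - i.+1 < k)%N by rewrite ltn_subrL (leq_trans _ lt_ik).
rewrite big_ltn // avoiding_first subnSK //.
rewrite [_ ^+ i.+1]exprS -mulrA -IHi ?(ltnW lt_ik) //.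
(* With P the left side for [i], the series of the new letter [k - i.+1] is P by [avoiding_first],
   so the left side for [i.+1] is P - x^2 P. *)
by ring.
Qed.

Theorem theorem3p10 (k : nat) :
  fracps (F122 k) =
    fracps (fpsX int)
      / fracps ((1 - fpsX int ^+ 2) ^+ k - (1 - fpsX int))
    :> {fraction fps int}.
Proof.
have FD : F122 k * ((1 - fpsX int ^+ 2) ^+ k - (1 - fpsX int)) = fpsX int.
  rewrite F122_avoiding mulrBr mulrC -avoiding_tail // subnn big_mkord.
  have := avoiding_rcons k [::]; rewrite contains122_short //=.
  set S := \sum_(a < k) _ => FS.
  have -> : fpsX int ^+ 2 * S = fpsX int * (avoiding k [::] - 1).
    by rewrite FS addrC addKr mulrA expr2.
  by ring.
have D_neq0 : (1 - fpsX int ^+ 2) ^+ k - (1 - fpsX int) != 0.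
  (* A zero denominator would turn [FD] into 0 = x, which fails at the coefficient of degree 1. *)
  apply/eqP => D0; have /fpsP/(_ 1%N) := FD.
  by rewrite D0 mulr0.
by rewrite -[X in fracps X / _]FD tofracM mulfK ?tofrac_eq0.
Qed.
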